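(* Let $R$ be a commutative von Neumann regular ring with $\operatorname{char}(R) = 2$. Then every proper ideal of $R$ is an sdf-absorbing ideal of $R$.
   Context: All rings are commutative with identity $1 \neq 0$. A proper ideal $I$ of a commutative ring $R$ is a square-difference factor absorbing ideal (sdf-absorbing ideal) of $R$ if whenever $a, b \in R$ are both nonzero and $a^2 - b^2 \in I$, then $a + b \in I$ or $a - b \in I$. A commutative ring $R$ is von Neumann regular if for every $x \in R$ there is a $y \in R$ with $x^2 y = x$. *)

(* Defs.v *)
From mathcomp Require Import all_boot all_order all_algebra.
From mathcomp Require Import boolp classical_sets.

Set Implicit Arguments.
Unset Strict Implicit.
Unset Printing Implicit Defensive.

Import GRing.Theory.
Local Open Scope ring_scope.

Definition von_neumann_regular (R : comNzRingType) : Prop :=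
  forall x : R, exists y : R, x ^+ 2 * y = x.

(* [idealr_closed] is stated for boolean predicates and includes properness
   (1 \notin I); the classical [\in] on [set R] makes it available for
   arbitrary, not only decidable, subsets of R. *)
Definition proper_ideal_set (R : comNzRingType) (I : set R) : Prop :=
  idealr_closed [in I].

Definition sdf_absorbing (R : comNzRingType) (I : set R) : Prop :=
  proper_ideal_set I /\
  forall a b : R, a != 0 -> b != 0 ->
    a ^+ 2 - b ^+ 2 \in I -> a + b \in I \/ a - b \in I.

(* Main.v *)
Require Import Defs.
From mathcomp Require Import all_boot all_order all_algebra.
From mathcomp Require Import boolp classical_sets.

(** In characteristic 2 the signs disappear, so [a ^+ 2 - b ^+ 2] is the square
    of [a + b].  In a von Neumann regular ring every element is a multiple of
    its own square, so every ideal is radical for squares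
    ([ideal_sqr_mem_regular]), and [a + b] already lies in the ideal. *)

Import GRing.Theory.
Local Open Scope ring_scope.

(** Regularity gives [x = y * x ^+ 2] for some [y], and ideals absorb
    multiples. *)
Lemma ideal_sqr_mem_regular (R : comNzRingType) (I : set R) (x : R) :
  von_neumann_regular R -> proper_ideal_set I -> x ^+ 2 \in I -> x \in I.
Proof.
move=> vnrR [I0 _ I_lin] x2I; have [y x2y] := vnrR x.
by rewrite -x2y mulrC -[_ * _]addr0; apply: I_lin.
Qed.

Lemma subr_sqr_pchar2 (R : comNzRingType) (a b : R) :
  2%N \in [pchar R] -> a ^+ 2 - b ^+ 2 = (a + b) ^+ 2.
Proof. by move=> charR; rewrite subr_sqr (oppr_pchar2 charR) expr2. Qed.

Local Close Scope ring_scope.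

Theorem theorem3p6 (R : comNzRingType) (vnrR : von_neumann_regular R)
    (charR : 2%N \in [pchar R]%R) (I : set R) :
  proper_ideal_set I -> sdf_absorbing I.
Proof.
move=> idI; split=> // a b _ _; rewrite subr_sqr_pchar2 // => sqI.
by left; apply: ideal_sqr_mem_regular sqI.
Qed.
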